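(* Let $p$ be a prime, $n \ge 0$, and let $C_{p^n}$ be the cyclic group of order $p^n$. If $k$ is a field-like $C_{p^n}$-Tambara functor, then there exist $0 \le i \le n$ and a clarified $C_{p^i}$-Tambara functor $\ell$ such that $$k \cong \mathrm{Coind}_{i}^{n}\, \ell$$ as $C_{p^n}$-Tambara functors.
   Context: For a finite group $G$, a $G$-Tambara functor $k$ assigns to each finite $G$-set $X$ a commutative ring $k(X)$ (taking disjoint unions to products) and to each map $X \to Y$ of finite $G$-sets a restriction $k(Y)\to k(X)$ (a ring map), an additive transfer $k(X)\to k(Y)$ and a multiplicative norm $k(X)\to k(Y)$, satisfying the standard axioms (as in Tambara, Strickland). It is determined by the levels $k(G/H)$; the Weyl group $N_GH/H$ acts on $k(G/H)$, in particular $G$ acts on $k(G/e)$. Morphisms are levelwise ring maps compatible with all this structure. A nonzero $G$-Tambara functor $k$ is field-like (or a $G$-Tambara field) if every morphism $k \to \ell$ with $\ell \neq 0$ is monic. (Nakaoka: equivalently, all restriction maps of $k$ are injective and $k(G/e)$ is nonzero with no nontrivial $G$-invariant ideals.) An $H$-ring is a commutative ring with an action of $H$ by ring automorphisms. For $H \subset G$ and an $H$-ring $R$, $\mathrm{Coind}_H^G R = \mathrm{Fun}(G/H,R)$ denotes the coinduced $G$-ring, i.e. the value at $R$ of the right adjoint of restriction from $G$-rings to $H$-rings. A field-like $G$-Tambara functor $k$ is separated if $k(G/e) \cong \mathrm{Coind}_H^G R$ as $G$-rings for some proper subgroup $H \subsetneq G$ and some $H$-ring $R$; otherwise it is clarified.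 In particular, clarified functors are field-like. For an $H$-Tambara functor $\ell$, $\mathrm{Coind}_H^G \ell$ is the $G$-Tambara functor $X \mapsto \ell(\mathrm{Res}_H^G X)$, obtained by precomposing with restriction of finite $G$-sets to finite $H$-sets; it is right adjoint to restriction of Tambara functors. $\mathrm{Coind}_i^n$ denotes coinduction from $C_{p^i}$ to $C_{p^n}$. *)

(* Defs.v *)
From HB Require Import structures.
From mathcomp Require Import all_boot all_order all_fingroup all_algebra.
From mathcomp Require Import cyclic.

Set Implicit Arguments.
Unset Strict Implicit.
Unset Printing Implicit Defensive.

Import GRing.Theory.
Import GroupScope.

(* Convention: as everywhere in the library, groups act on the right, both on
   finite sets and on rings.  Left actions are recovered through g |-> g^-1. *)

Section FiniteGSets.
Variable gT : finGroupType.

Record gset := GSet {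
  gset_sort :> finType;
  gset_act : {action gT &-> gset_sort}
}.

Record gmap (X Y : gset) := GMap {
  gmap_fun :> X -> Y;
  gmap_equiv : forall x g, gmap_fun (gset_act X x g) = gset_act Y (gmap_fun x) g
}.

Definition gmap_id (X : gset) : gmap X X := @GMap X X id (fun _ _ => erefl).

Fact gmap_comp_equiv (X Y Z : gset) (v : gmap Y Z) (u : gmap X Y) x g :
  v (u (gset_act X x g)) = gset_act Z (v (u x)) g.
Proof. by rewrite !gmap_equiv. Qed.

Definition gmap_comp (X Y Z : gset) (v : gmap Y Z) (u : gmap X Y) : gmap X Z :=
  @GMap X Z (fun x => v (u x)) (gmap_comp_equiv v u).

(* The orbit G/e. *)
Definition gset_reg : gset := @GSet gT 'R%act.

Fact left_mul_equiv (a x g : gset_reg) :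
  a * gset_act gset_reg x g = gset_act gset_reg (a * x) g.
Proof. exact: mulgA. Qed.

Definition left_mul (a : gT) : gmap gset_reg gset_reg :=
  @GMap gset_reg gset_reg (fun x => a * x) (left_mul_equiv a).

Definition gset_empty_act (x : void) (g : gT) : void := x.

Definition gset_empty : gset :=
  @GSet void (@TotalAction gT void gset_empty_act (fun _ => erefl)
                (fun _ _ _ => erefl)).

Section Sum.
Variables X Y : gset.

Definition gset_sum_act (z : X + Y) (g : gT) : X + Y :=
  match z with
  | inl x => inl (gset_act X x g)
  | inr y => inr (gset_act Y y g)
  end.

Fact gset_sum_act1 : gset_sum_act^~ 1 =1 id.
Proof. by case=> z /=; rewrite act1. Qed.

Fact gset_sum_actM z : act_morph gset_sum_act z.
Proof. by move=> g h; case: z => z /=; rewrite actM. Qed.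

Definition gset_sum : gset :=
  @GSet (X + Y)%type (TotalAction gset_sum_act1 gset_sum_actM).

Definition gset_inl : gmap X gset_sum := @GMap X gset_sum inl (fun _ _ => erefl).
Definition gset_inr : gmap Y gset_sum := @GMap Y gset_sum inr (fun _ _ => erefl).
End Sum.

Definition is_pullback (W X Y Z : gset)
    (u' : gmap W X) (v' : gmap W Y) (v : gmap X Z) (u : gmap Y Z) : Prop :=
  (forall w, v (u' w) = u (v' w)) /\
  (forall x y, v x = u y -> exists! w, u' w = x /\ v' w = y).

Section Pullback.
Variables (X Y Z : gset) (v : gmap X Z) (u : gmap Y Z).

Definition pb_type : finType := {xy : X * Y | v xy.1 == u xy.2}.

Fact pb_act_subproof (w : pb_type) (g : gT) :
  v (gset_act X (val w).1 g) == u (gset_act Y (val w).2 g).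
Proof. by rewrite !gmap_equiv (eqP (valP w)). Qed.

Definition pb_act (w : pb_type) (g : gT) : pb_type :=
  exist _ (gset_act X (val w).1 g, gset_act Y (val w).2 g) (pb_act_subproof w g).

Fact pb_act1 : pb_act^~ 1 =1 id.
Proof. by move=> w; apply: val_inj; rewrite /= !act1; case: (val w). Qed.

Fact pb_actM w : act_morph pb_act w.
Proof. by move=> g h; apply: val_inj; rewrite /= !actM. Qed.

Definition pb : gset := @GSet pb_type (TotalAction pb_act1 pb_actM).

Definition pb1 : gmap pb X :=
  @GMap pb X (fun w => (val w).1) (fun _ _ => erefl).
Definition pb2 : gmap pb Y :=
  @GMap pb Y (fun w => (val w).2) (fun _ _ => erefl).
End Pullback.

(* For p : A -> X and f : X -> Y, the dependent product Pi_f A -> Y is the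
   G-set of pairs (y, s) with s : f^-1(y) -> A a section of p over the fibre
   f^-1(y); it sits in the exponential diagram

     X <-- p -- A <-- exp_eval -- X x_Y Pi_f A
     |                               |
     f                            exp_proj
     v                               v
     Y <--------- exp_base -------- Pi_f A

   The section s is encoded as a function X -> option A that is None exactly
   outside f^-1(y). *)
Section Exponential.
Variables (A X Y : gset) (p : gmap A X) (f : gmap X Y).

Definition is_fibre_section (ys : Y * {ffun X -> option A}) : bool :=
  [forall x, if ys.2 x is Some a then (f x == ys.1) && (p a == x)
             else f x != ys.1].

Definition exp_type : finType :=
  {ys : Y * {ffun X -> option A} | is_fibre_section ys}.

Definition exp_raw_act (ys : Y * {ffun X -> option A}) (g : gT) :=
  (gset_act Y ys.1 g,
   [ffun x => omap (fun a => gset_act A a g) (ys.2 (gset_act X x g^-1))]).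

Fact exp_act_subproof (w : exp_type) (g : gT) :
  is_fibre_section (exp_raw_act (val w) g).
Proof.
case: w => -[y s] /= /forallP ws; apply/forallP=> x /=; rewrite ffunE.
have := ws (gset_act X x g^-1); rewrite /= gmap_equiv.
have fg z : (gset_act Y z g^-1 == y) = (z == gset_act Y y g).
  by rewrite (can2_eq (actKV _ g) (actK _ g)).
by case: (s _) => [a|] /=; rewrite fg // gmap_equiv => /andP[-> /eqP->] /=;
   rewrite actKV.
Qed.

Definition exp_act (w : exp_type) (g : gT) : exp_type :=
  exist _ (exp_raw_act (val w) g) (exp_act_subproof w g).

Fact exp_act1 : exp_act^~ 1 =1 id.
Proof.
move=> w; apply: val_inj; case: w => -[y s] /= _.
rewrite /exp_raw_act /= act1; congr pair; apply/ffunP=> x.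
by rewrite ffunE invg1 act1; case: (s x) => //= a; rewrite act1.
Qed.

Fact exp_actM w : act_morph exp_act w.
Proof.
move=> g h; apply: val_inj; case: w => -[y s] /= _.
rewrite /exp_raw_act /= actM; congr pair; apply/ffunP=> x.
by rewrite !ffunE invMg actM; case: (s _) => //= a; rewrite actM.
Qed.

Definition exp_gset : gset := @GSet exp_type (TotalAction exp_act1 exp_actM).

Definition exp_base : gmap exp_gset Y :=
  @GMap exp_gset Y (fun w => (val w).1) (fun _ _ => erefl).

Definition exp_pb : gset := pb f exp_base.

Definition exp_proj : gmap exp_pb exp_gset := pb2 f exp_base.

Fact exp_eval_subproof (z : exp_pb) : isSome ((val (val z).2).2 (val z).1).
Proof.
case: z => -[x [[y s] /= /forallP ws]] /= fx.
by have := ws x; rewrite /= (eqP fx) eqxx; case: (s x).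
Qed.

Definition osome (T : Type) (o : option T) : isSome o -> T :=
  match o with
  | Some a => fun _ => a
  | None => fun no => False_rect T (notF no)
  end.

Definition exp_eval_fun (z : exp_pb) : A := osome (exp_eval_subproof z).

Fact exp_eval_funP (z : exp_pb) a :
  (exp_eval_fun z = a) <-> ((val (val z).2).2 (val z).1 = Some a).
Proof.
rewrite /exp_eval_fun; move: (exp_eval_subproof z).
by case: (_ (val z).1) => [b|//] _ /=; split=> [->|[->]].
Qed.

Fact exp_eval_equiv (z : exp_pb) g :
  exp_eval_fun (gset_act exp_pb z g) = gset_act A (exp_eval_fun z) g.
Proof.
apply/exp_eval_funP; rewrite /= ffunE actK.
by have /exp_eval_funP-> : exp_eval_fun z = exp_eval_fun z by [].
Qed.

Definition exp_eval : gmap exp_pb A := @GMap exp_pb A exp_eval_fun exp_eval_equiv.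
End Exponential.
End FiniteGSets.

Arguments gset_sum {gT}.
Arguments gset_inl {gT}.
Arguments gset_inr {gT}.
Arguments gset_empty {gT}.

(* Finite disjoint unions go to products, transfers and norms satisfy base change
   along pullback squares, and norms distribute over transfers along exponential
   diagrams.  Since tr is additive and nm multiplicative, the axioms force the
   ring operations of k(X) to be the transfer and norm along the fold map. *)
Record tambara (gT : finGroupType) := Tambara {
  tval :> gset gT -> comPzRingType;
  res : forall X Y : gset gT, gmap X Y -> {rmorphism tval Y -> tval X};
  tr : forall X Y : gset gT, gmap X Y -> {additive tval X -> tval Y};
  nm : forall X Y : gset gT, gmap X Y -> tval X -> tval Y;
  nm_monoid : forall (X Y : gset gT) (u : gmap X Y), monoid_morphism (nm u);
  (* Functoriality is stated up to pointwise equality of maps of G-sets. *)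
  res_id : forall (X : gset gT) (u : gmap X X), u =1 id ->
    forall a, res u a = a;
  tr_id : forall (X : gset gT) (u : gmap X X), u =1 id ->
    forall a, tr u a = a;
  nm_id : forall (X : gset gT) (u : gmap X X), u =1 id ->
    forall a, nm u a = a;
  res_comp : forall (X Y Z : gset gT) (v : gmap Y Z) (u : gmap X Y)
      (w : gmap X Z), w =1 v \o u -> forall a, res w a = res u (res v a);
  tr_comp : forall (X Y Z : gset gT) (v : gmap Y Z) (u : gmap X Y)
      (w : gmap X Z), w =1 v \o u -> forall a, tr w a = tr v (tr u a);
  nm_comp : forall (X Y Z : gset gT) (v : gmap Y Z) (u : gmap X Y)
      (w : gmap X Z), w =1 v \o u -> forall a, nm w a = nm v (nm u a);
  tval_empty : forall a b : tval gset_empty, a = b;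
  tval_sum : forall X Y : gset gT,
    bijective (fun a : tval (gset_sum X Y) =>
                 (res (gset_inl X Y) a, res (gset_inr X Y) a));
  res_tr : forall (W X Y Z : gset gT) (u' : gmap W X) (v' : gmap W Y)
      (v : gmap X Z) (u : gmap Y Z), is_pullback u' v' v u ->
    forall a, res v (tr u a) = tr u' (res v' a);
  res_nm : forall (W X Y Z : gset gT) (u' : gmap W X) (v' : gmap W Y)
      (v : gmap X Z) (u : gmap Y Z), is_pullback u' v' v u ->
    forall a, res v (nm u a) = nm u' (res v' a);
  nm_tr : forall (A X Y : gset gT) (p : gmap A X) (f : gmap X Y) a,
    nm f (tr p a) = tr (exp_base p f) (nm (exp_proj p f) (res (exp_eval p f) a))
}.

Arguments res {gT} t {X Y}.
Arguments tr {gT} t {X Y}.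
Arguments nm {gT} t {X Y}.

Section Morphisms.
Variable gT : finGroupType.

Record tmor (k l : tambara gT) := TMor {
  tmor_fun :> forall X : gset gT, {rmorphism k X -> l X};
  tmor_res : forall (X Y : gset gT) (u : gmap X Y) a,
    tmor_fun X (res k u a) = res l u (tmor_fun Y a);
  tmor_tr : forall (X Y : gset gT) (u : gmap X Y) a,
    tmor_fun Y (tr k u a) = tr l u (tmor_fun X a);
  tmor_nm : forall (X Y : gset gT) (u : gmap X Y) a,
    tmor_fun Y (nm k u a) = nm l u (tmor_fun X a)
}.

Definition tambara_iso (k l : tambara gT) : Prop :=
  exists (phi : tmor k l) (psi : tmor l k),
    forall X, cancel (phi X) (psi X) /\ cancel (psi X) (phi X).

Definition tambara_nonzero (k : tambara gT) : Prop :=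
  exists X : gset gT, 1%R <> 0%R :> k X.

Definition tambara_monic (k l : tambara gT) (phi : tmor k l) : Prop :=
  forall (j : tambara gT) (alpha beta : tmor j k),
    (forall X a, phi X (alpha X a) = phi X (beta X a)) ->
    forall X, alpha X =1 beta X.

Definition field_like (k : tambara gT) : Prop :=
  tambara_nonzero k /\
  forall (l : tambara gT) (phi : tmor k l), tambara_nonzero l -> tambara_monic phi.

Record gring := GRing {
  gring_sort :> comPzRingType;
  gring_act : gT -> {rmorphism gring_sort -> gring_sort};
  gring_act1 : forall a, gring_act 1 a = a;
  gring_actM : forall g h a, gring_act (g * h) a = gring_act h (gring_act g a)
}.

Definition gring_iso (R S : gring) : Prop :=
  exists2 phi : {rmorphism R -> S},
    bijective phi & forall g a, phi (gring_act R g a) = gring_act S g (phi a).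

Section Bottom.
Variable k : tambara gT.

Fact bottom_act1 a : res k (left_mul (1 : gT)) a = a.
Proof. by apply: res_id => x /=; rewrite mul1g. Qed.

Fact bottom_actM (g h : gT) a :
  res k (left_mul (g * h)) a = res k (left_mul h) (res k (left_mul g) a).
Proof. by apply: res_comp => x /=; rewrite mulgA. Qed.

(* k(G/e): the G-set automorphisms of G/e are the left multiplications, on
   which k is contravariant, so that G acts on the right. *)
Definition bottom : gring :=
  @GRing (k (gset_reg gT)) (fun g => res k (left_mul g)) bottom_act1 bottom_actM.
End Bottom.
End Morphisms.

(* Coind_H^G R is the ring of H-equivariant maps from G to R, G acting by left
   translation of the argument; evaluation on coset representatives identifies
   it with Fun(G/H, R). *)
Section CoinducedRing.
Variables (gT : finGroupType) (H : {group gT}) (R : gring (subg_of H)).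
Local Open Scope ring_scope.

Definition coind_pred : pred {ffun gT -> R} :=
  fun f => [forall x, forall h : subg_of H,
              f (x * sgval h)%g == gring_act R h (f x)].

Fact coind_predP (f : {ffun gT -> R}) :
  reflect (forall x (h : subg_of H), f (x * sgval h)%g = gring_act R h (f x))
          (f \in coind_pred).
Proof.
by apply: (iffP forallP) => fP x; [move=> h; apply/eqP/(forallP (fP x))
                                  | apply/forallP=> h; apply/eqP].
Qed.

Fact coind_pred_subring : subring_closed coind_pred.
Proof.
split=> [|f g /coind_predP fP /coind_predP gP|f g /coind_predP fP /coind_predP gP];
  apply/coind_predP=> x h; rewrite !ffunE ?rmorph1 //.
- by rewrite fP gP rmorphB.
- by rewrite fP gP rmorphM.
Qed.

HB.instance Definition _ :=
  GRing.isSubringClosed.Build {ffun gT -> R} coind_pred coind_pred_subring.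

Record coind_type := CoindType {
  coind_val :> {ffun gT -> R};
  coind_valP : coind_val \in coind_pred
}.

HB.instance Definition _ := [isSub for coind_val].
HB.instance Definition _ := [Choice of coind_type by <:].
HB.instance Definition _ :=
  GRing.SubChoice_isSubPzRing.Build _ _ coind_type (subringClosedP _).

Fact coind_type_mulC : commutative (@GRing.mul coind_type).
Proof.
by move=> f g; apply: val_inj; apply/ffunP=> x; rewrite !ffunE mulrC.
Qed.

HB.instance Definition _ :=
  GRing.PzRing_hasCommutativeMul.Build coind_type coind_type_mulC.

Fact coind_act_subproof (g : gT) (f : coind_type) :
  [ffun x : gT => coind_val f (g * x)%g] \in coind_pred.
Proof.
by apply/coind_predP=> x h; rewrite !ffunE mulgA (coind_predP _ (coind_valP f)).
Qed.

Definition coind_act (g : gT) (f : coind_type) : coind_type :=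
  CoindType (coind_act_subproof g f).

Fact coind_act_zmod_morphism g : zmod_morphism (coind_act g).
Proof. by move=> f1 f2; apply: val_inj; apply/ffunP=> x; rewrite !ffunE. Qed.

Fact coind_act_monoid_morphism g : monoid_morphism (coind_act g).
Proof.
by split=> [|f1 f2]; apply: val_inj; apply/ffunP=> x; rewrite !ffunE.
Qed.

HB.instance Definition _ (g : gT) :=
  GRing.isZmodMorphism.Build coind_type coind_type (coind_act g)
    (coind_act_zmod_morphism g).
HB.instance Definition _ (g : gT) :=
  GRing.isMonoidMorphism.Build coind_type coind_type (coind_act g)
    (coind_act_monoid_morphism g).

Fact coind_act1 f : coind_act 1%g f = f.
Proof. by apply: val_inj; apply/ffunP=> x; rewrite ffunE mul1g. Qed.

Fact coind_actM g h f : coind_act (g * h)%g f = coind_act h (coind_act g f).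
Proof. by apply: val_inj; apply/ffunP=> x; rewrite !ffunE mulgA. Qed.

Definition coind_gring : gring gT :=
  @GRing gT coind_type (fun g => coind_act g) coind_act1 coind_actM.
End CoinducedRing.

Definition separated (gT : finGroupType) (k : tambara gT) : Prop :=
  field_like k /\
  exists (H : {group gT}) (R : gring (subg_of H)),
    H \proper [set: gT] /\ gring_iso (bottom k) (coind_gring R).

Definition clarified (gT : finGroupType) (k : tambara gT) : Prop :=
  field_like k /\ ~ separated k.

Section TransferIso.
Variables (gT : finGroupType) (l : tambara gT) (X Y : gset gT).
Variables (u : gmap X Y) (v : gmap Y X).
Hypotheses (uK : cancel u v) (vK : cancel v u).

Lemma res_isoK : cancel (res l u) (res l v).
Proof.
move=> a; rewrite -(@res_comp _ l _ _ _ u v (gmap_id Y)); last by move=> y; rewrite /= vK.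
exact: res_id.
Qed.

Fact iso_pullback : is_pullback (gmap_id X) (gmap_id X) u u.
Proof.
by split=> // x y /(can_inj uK) ->; exists y; split=> // w [].
Qed.

Lemma tr_iso a : tr l u a = res l v a.
Proof. by rewrite -[LHS]res_isoK (res_tr iso_pullback) tr_id // res_id. Qed.

Lemma nm_iso a : nm l u a = res l v a.
Proof. by rewrite -[LHS]res_isoK (res_nm iso_pullback) nm_id // res_id. Qed.
End TransferIso.

Section CoinducedTambara.
Variables (gT : finGroupType) (H : {group gT}).
Let hT : finGroupType := subg_of H.

Section ResGset.
Variable X : gset gT.
Definition res_gset_act (x : X) (h : hT) : X := gset_act X x (sgval h).

Fact res_gset_act1 : res_gset_act^~ 1 =1 id.
Proof. by move=> x; rewrite /res_gset_act act1. Qed.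

Fact res_gset_actM x : act_morph res_gset_act x.
Proof. by move=> g h; rewrite /res_gset_act actM. Qed.

Definition res_gset : gset hT :=
  @GSet hT X (TotalAction res_gset_act1 res_gset_actM).
End ResGset.

Fact res_gmap_equiv (X Y : gset gT) (u : gmap X Y) (x : X) (h : hT) :
  u (gset_act (res_gset X) x h) = gset_act (res_gset Y) (u x) h.
Proof. exact: gmap_equiv. Qed.

Definition res_gmap (X Y : gset gT) (u : gmap X Y) :
  gmap (res_gset X) (res_gset Y) :=
  @GMap hT (res_gset X) (res_gset Y) u (res_gmap_equiv u).

(* Restriction commutes with disjoint unions, fibre products and dependent
   products: the comparison maps are identities on underlying sets. *)
Definition res_empty_to : gmap (gset_empty : gset hT) (res_gset gset_empty) :=
  @GMap hT gset_empty (res_gset gset_empty) id (fun _ _ => erefl).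
Definition res_empty_from : gmap (res_gset gset_empty) (gset_empty : gset hT) :=
  @GMap hT (res_gset gset_empty) gset_empty id (fun _ _ => erefl).

Section ResSum.
Variables X Y : gset gT.
Let S1 := gset_sum (res_gset X) (res_gset Y).
Let S2 := res_gset (gset_sum X Y).
Fact res_sum_equiv (z : S1) (h : hT) : gset_act S1 z h = gset_act S2 z h.
Proof. by case: z. Qed.
Definition res_sum_to : gmap S1 S2 := @GMap hT S1 S2 id res_sum_equiv.
Definition res_sum_from : gmap S2 S1 :=
  @GMap hT S2 S1 id (fun z h => esym (res_sum_equiv z h)).
End ResSum.

Section ResExp.
Variables (A X Y : gset gT) (p : gmap A X) (f : gmap X Y).
Let P1 := exp_gset (res_gmap p) (res_gmap f).
Let P2 := res_gset (exp_gset p f).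
Let E1 := exp_pb (res_gmap p) (res_gmap f).
Let E2 := res_gset (exp_pb p f).

Fact res_exp_equiv (w : P1) (h : hT) : gset_act P1 w h = gset_act P2 w h.
Proof. exact: val_inj. Qed.
Definition res_exp_to : gmap P1 P2 := @GMap hT P1 P2 id res_exp_equiv.
Definition res_exp_from : gmap P2 P1 :=
  @GMap hT P2 P1 id (fun w h => esym (res_exp_equiv w h)).

Fact res_pb_equiv (z : E1) (h : hT) : gset_act E1 z h = gset_act E2 z h.
Proof.
by apply: val_inj; congr pair; apply: (res_exp_equiv (val z).2).
Qed.
Definition res_pb_to : gmap E1 E2 := @GMap hT E1 E2 id res_pb_equiv.
Definition res_pb_from : gmap E2 E1 :=
  @GMap hT E2 E1 id (fun z h => esym (res_pb_equiv z h)).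
End ResExp.

Variable l : tambara hT.

Fact coind_nm_monoid (X Y : gset gT) (u : gmap X Y) :
  monoid_morphism (nm l (res_gmap u)).
Proof. exact: nm_monoid. Qed.

Fact coind_empty (a b : l (res_gset gset_empty)) : a = b.
Proof.
apply: (can_inj (@res_isoK _ l _ _ res_empty_to res_empty_from _)) => //.
exact: tval_empty.
Qed.

Fact coind_sum (X Y : gset gT) :
  bijective (fun a : l (res_gset (gset_sum X Y)) =>
    (res l (res_gmap (gset_inl X Y)) a, res l (res_gmap (gset_inr X Y)) a)).
Proof.
pose i := res_sum_to X Y; pose j := res_sum_from X Y.
apply: (@eq_bij _ _ ((fun a => (res l (gset_inl _ _) a, res l (gset_inr _ _) a))
                       \o res l i)).
  apply: bij_comp; first exact: tval_sum.
  by exists (res l j); apply: res_isoK.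
by move=> a /=; congr pair; apply/esym/res_comp.
Qed.

Fact coind_nm_tr (A X Y : gset gT) (p : gmap A X) (f : gmap X Y) a :
  nm l (res_gmap f) (tr l (res_gmap p) a) =
  tr l (res_gmap (exp_base p f))
    (nm l (res_gmap (exp_proj p f)) (res l (res_gmap (exp_eval p f)) a)).
Proof.
pose P := res_exp_to p f; pose E := res_pb_to p f; pose E' := res_pb_from p f.
have evE : exp_eval (res_gmap p) (res_gmap f) \o E' =1 exp_eval p f.
  by move=> z; apply/exp_eval_funP/(exp_eval_funP z).
rewrite nm_tr (@tr_comp _ l _ _ _ (res_gmap (exp_base p f)) P) //.
rewrite (@tr_iso _ l _ _ P (res_exp_from p f)) //.
rewrite -(@nm_iso _ l _ _ P (res_exp_from p f)) //.
rewrite -(@nm_comp _ l _ _ _ P _ (gmap_comp P (exp_proj _ _))) //.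
rewrite (@nm_comp _ l _ _ _ (res_gmap (exp_proj p f)) E) //.
rewrite (@nm_iso _ l _ _ E E') //.
by rewrite -(@res_comp _ l _ _ _ _ _ (res_gmap (exp_eval p f))).
Qed.

Definition coind : tambara gT :=
  @Tambara gT (fun X => l (res_gset X))
    (fun X Y u => res l (res_gmap u))
    (fun X Y u => tr l (res_gmap u))
    (fun X Y u => nm l (res_gmap u))
    coind_nm_monoid
    (fun X u uE => @res_id _ l _ (res_gmap u) uE)
    (fun X u uE => @tr_id _ l _ (res_gmap u) uE)
    (fun X u uE => @nm_id _ l _ (res_gmap u) uE)
    (fun X Y Z v u w wE => @res_comp _ l _ _ _ (res_gmap v) (res_gmap u) (res_gmap w) wE)
    (fun X Y Z v u w wE => @tr_comp _ l _ _ _ (res_gmap v) (res_gmap u) (res_gmap w) wE)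
    (fun X Y Z v u w wE => @nm_comp _ l _ _ _ (res_gmap v) (res_gmap u) (res_gmap w) wE)
    coind_empty coind_sum
    (fun W X Y Z u' v' v u sq =>
       @res_tr _ l _ _ _ _ (res_gmap u') (res_gmap v') (res_gmap v) (res_gmap u) sq)
    (fun W X Y Z u' v' v u sq =>
       @res_nm _ l _ _ _ _ (res_gmap u') (res_gmap v') (res_gmap v) (res_gmap u) sq)
    coind_nm_tr.
End CoinducedTambara.

(* Main.v *)
Require Import Defs.
From HB Require Import structures.
From mathcomp Require Import all_boot all_fingroup all_algebra.
From mathcomp Require Import cyclic boolp.

(** Write G both for the group and for its free orbit, so that k(G) is the
    bottom ring.  The proof descends k along a ring morphism out of k(G), for a
    finite group G ([clarified_coinduction]); by Lagrange, the subgroup that it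
    finds has order a power of p when G does.

    An element b of k(X) gives a function on the points of X with values in
    k(G): restrict b along the orbit map G -> X of each point ([ev]).  The
    pullback of X -> Y along an orbit map G -> Y is a disjoint union of copies
    of G, one for each point of the fibre, so transfers become sums over fibres
    and norms become products over fibres ([ev_tr], [ev_nm]).  Conversely, any
    family of subrings of the rings of all functions from X to a ring R that is
    stable under precomposition, fibrewise sums and fibrewise products is a
    Tambara functor ([fsub]).

    Let q : k(G) -> R be a ring morphism and e an element of k(G) such that
    q(e.g) is 1 for g in H and 0 for g outside H ([detects]).  If k(G) is
    coinduced from a ring S over H, evaluation at 1 and the indicator function
    of H are such a pair.  For an H-set Y, let l(Y) be the ring of functions
    y |-> q(b(y)), for b in k(G x_H Y), where Y is seen inside G x_H Y
    ([desc]).  The functions x |-> q(b(x)), for b in k(X), define a morphism from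
    k to the coinduction of l ([desc_unit]).  It is injective because k is
    field-like: a monic morphism of Tambara functors is levelwise injective, by
    comparing the two projections of its kernel pair ([monic_inj]).  It is
    surjective because the norm of e to G/H is sent by q to the indicator of
    the base coset: multiplying by it kills, in the transfer of b from G x_H X
    to X, every summand except the one at the point of X itself
    ([desc_unit_surj]).  So k is coinduced from l, and l inherits from k the
    property of being field-like ([desc_field_like]).

    Finally take H of least order among the subgroups that admit such a pair
    (q, e) with R nonzero; the group G itself is one, with q the identity and
    e = 1.  If l were separated, coinduced at the bottom from a proper subgroup
    K of H, then extending the indicator of K by zero from H to G would give a
    pair for K ([detects_smaller]).  So l is clarified. *)

Set Implicit Arguments.
Unset Strict Implicit.
Unset Printing Implicit Defensive.

Import GRing.Theory.
Local Open Scope ring_scope.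

(** * Values at points *)

Lemma big_fibre_bij (S : Type) (idx : S) (op : Monoid.com_law idx)
    (I J : finType) (P : pred I) (Q : pred J) (h : J -> I) (F : I -> S) :
    (forall j, Q j -> P (h j)) ->
    (forall i, P i -> exists2 j, Q j & h j = i) ->
    {in Q &, injective h} ->
  \big[op/idx]_(i | P i) F i = \big[op/idx]_(j | Q j) F (h j).
Proof.
move=> QP PQ injh; rewrite -[RHS](@big_imset _ _ _ _ _ h Q F injh) /=.
apply: eq_bigl => i; apply/idP/imsetP => [/PQ [j Qj <-]|[j Qj ->]].
  by exists j.
exact: QP.
Qed.

Section Evaluation.
Variables (gT : finGroupType) (k : tambara gT).
Local Notation reg := (gset_reg gT).

Fact orb_equiv (X : gset gT) (x : X) (a g : reg) :
  gset_act X x (gset_act reg a g) = gset_act X (gset_act X x a) g.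
Proof. exact: actM. Qed.

Definition orb (X : gset gT) (x : X) : gmap reg X :=
  @GMap gT reg X (fun g => gset_act X x g) (orb_equiv x).

Definition ev (X : gset gT) (b : k X) (x : X) : k reg := res k (orb x) b.

Lemma ev_res (X Y : gset gT) (u : gmap X Y) b x : ev (res k u b) x = ev b (u x).
Proof. by rewrite /ev; apply/esym/res_comp => g /=; rewrite gmap_equiv. Qed.

Lemma ev_reg (a : k reg) (g : reg) : ev a g = res k (left_mul g) a.
Proof.
rewrite /ev -[RHS](res_id (u := gmap_id reg)) //.
by rewrite -(@res_comp _ k _ _ _ (left_mul g) _ (orb g)).
Qed.

Fact void_equiv (Z : gset gT) (x : gset_empty) (g : gT) :
  (of_void Z (gset_act gset_empty x g)) = gset_act Z (of_void Z x) g.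
Proof. by case: x. Qed.

Definition from_empty (Z : gset gT) : gmap gset_empty Z :=
  @GMap gT gset_empty Z (of_void Z) (@void_equiv Z).

Section Copair.
Variables (X Y Z : gset gT) (f : gmap X Z) (g : gmap Y Z).
Definition copair_fun (z : gset_sum X Y) : Z :=
  match z with inl x => f x | inr y => g y end.
Fact copair_equiv z h :
  copair_fun (gset_act (gset_sum X Y) z h) = gset_act Z (copair_fun z) h.
Proof. by case: z => z /=; rewrite gmap_equiv. Qed.
Definition copair : gmap (gset_sum X Y) Z := @GMap gT _ _ _ copair_equiv.
End Copair.

Lemma empty_pullbackl (X Y : gset gT) :
  is_pullback (from_empty X) (from_empty Y) (gset_inl X Y) (gset_inr X Y).
Proof. by split=> [[]|]. Qed.

Lemma empty_pullbackr (X Y : gset gT) :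
  is_pullback (from_empty Y) (from_empty X) (gset_inr X Y) (gset_inl X Y).
Proof. by split=> [[]|]. Qed.

Lemma inj_pullback (X Y : gset gT) (u : gmap X Y) : injective u ->
  is_pullback (gmap_id X) (gmap_id X) u u.
Proof. by move=> uI; split=> // x y /uI->; exists y; split=> // w []. Qed.

(** The fibre product of an injective map with itself is its source. *)
Lemma res_trK (X Y : gset gT) (u : gmap X Y) : injective u ->
  cancel (tr k u) (res k u).
Proof. by move=> uI a; rewrite (res_tr (inj_pullback uI)) res_id // tr_id. Qed.

Lemma res_nmK (X Y : gset gT) (u : gmap X Y) : injective u ->
  cancel (nm k u) (res k u).
Proof. by move=> uI a; rewrite (res_nm (inj_pullback uI)) res_id // nm_id. Qed.

Lemma nmM (X Y : gset gT) (u : gmap X Y) a b : nm k u (a * b) = nm k u a * nm k u b.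
Proof. by case: (nm_monoid k u) => _ ->. Qed.

Lemma nm1 (X Y : gset gT) (u : gmap X Y) : nm k u 1 = 1.
Proof. by case: (nm_monoid k u). Qed.

(** The ring of the empty set is zero, and tr is additive. *)
Lemma tr_from_empty (Z : gset gT) a : tr k (from_empty Z) a = 0.
Proof. by rewrite (tval_empty a 0) raddf0. Qed.

(** In the zero ring every element is 1, and norms preserve 1. *)
Lemma nm_from_empty (Z : gset gT) a : nm k (from_empty Z) a = 1.
Proof. by rewrite (tval_empty a 1) nm1. Qed.

Let inlI (X Y : gset gT) : injective (gset_inl X Y). Proof. by move=> ? ? []. Qed.
Let inrI (X Y : gset gT) : injective (gset_inr X Y). Proof. by move=> ? ? []. Qed.

Lemma sum_ext (X Y : gset gT) (a b : k (gset_sum X Y)) :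
  res k (gset_inl X Y) a = res k (gset_inl X Y) b ->
  res k (gset_inr X Y) a = res k (gset_inr X Y) b -> a = b.
Proof.
by move=> el er; apply: (bij_inj (tval_sum k X Y)) => /=; rewrite el er.
Qed.

Lemma res_inlDtr (X Y : gset gT) (a : k X) (b : k Y) :
  res k (gset_inl X Y) (tr k (gset_inl X Y) a + tr k (gset_inr X Y) b) = a.
Proof.
rewrite raddfD /= (res_trK (@inlI X Y)) (res_tr (empty_pullbackl X Y)).
by rewrite tr_from_empty addr0.
Qed.

Lemma res_inrDtr (X Y : gset gT) (a : k X) (b : k Y) :
  res k (gset_inr X Y) (tr k (gset_inl X Y) a + tr k (gset_inr X Y) b) = b.
Proof.
rewrite raddfD /= (res_trK (@inrI X Y)) (res_tr (empty_pullbackr X Y)).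
by rewrite tr_from_empty add0r.
Qed.

(** Transfers along the two inclusions invert the product decomposition of
    k at a disjoint union; hence [tr_sum], and likewise [nm_sum] with norms. *)
Lemma sum_trE (X Y : gset gT) (a : k (gset_sum X Y)) :
  tr k (gset_inl X Y) (res k (gset_inl X Y) a)
  + tr k (gset_inr X Y) (res k (gset_inr X Y) a) = a.
Proof. by apply: sum_ext; rewrite ?res_inlDtr ?res_inrDtr. Qed.

Lemma tr_sum (X Y Z : gset gT) (u : gmap (gset_sum X Y) Z) a :
  tr k u a = tr k (gmap_comp u (gset_inl X Y)) (res k (gset_inl X Y) a)
           + tr k (gmap_comp u (gset_inr X Y)) (res k (gset_inr X Y) a).
Proof.
rewrite (@tr_comp _ k _ _ _ u (gset_inl X Y)) //.
by rewrite (@tr_comp _ k _ _ _ u (gset_inr X Y)) // -raddfD sum_trE.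
Qed.

Lemma nm_sum (X Y Z : gset gT) (u : gmap (gset_sum X Y) Z) a :
  nm k u a = nm k (gmap_comp u (gset_inl X Y)) (res k (gset_inl X Y) a)
           * nm k (gmap_comp u (gset_inr X Y)) (res k (gset_inr X Y) a).
Proof.
rewrite (@nm_comp _ k _ _ _ u (gset_inl X Y)) //.
rewrite (@nm_comp _ k _ _ _ u (gset_inr X Y)) // -nmM; congr (nm k u _).
(* Norms along the inclusions extend an element by 1 to the other summand. *)
apply: sum_ext; rewrite rmorphM /=.
  by rewrite (res_nmK (@inlI X Y)) (res_nm (empty_pullbackl X Y)) nm_from_empty mulr1.
by rewrite (res_nmK (@inrI X Y)) (res_nm (empty_pullbackr X Y)) nm_from_empty mul1r.
Qed.

Lemma tr_ext (X Y : gset gT) (u v : gmap X Y) : u =1 v -> tr k u =1 tr k v.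
Proof.
by move=> uv a; rewrite (@tr_comp _ k _ _ _ v (gmap_id X) u) // (@tr_id _ k).
Qed.

Lemma nm_ext (X Y : gset gT) (u v : gmap X Y) : u =1 v -> nm k u =1 nm k v.
Proof.
by move=> uv a; rewrite (@nm_comp _ k _ _ _ v (gmap_id X) u) // (@nm_id _ k).
Qed.

Section Copies.
Variable X : gset gT.

(** One copy of the free orbit for each entry x of s; [copies_map] sends the
    copy of x to X through the orbit map of x, and [copies_fold] is the fold
    map.  When s enumerates the fibre of X -> Y over y, these are the two
    projections of the fibre product of X with the orbit map of y. *)
Fixpoint copies (s : seq X) : gset gT :=
  if s is _ :: s' then gset_sum reg (copies s') else gset_empty.

Fixpoint copies_map (s : seq X) : gmap (copies s) X :=
  match s return gmap (copies s) X with
  | [::] => from_empty X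
  | x :: s' => copair (orb x) (copies_map s')
  end.

Fixpoint copies_fold (s : seq X) : gmap (copies s) reg :=
  match s return gmap (copies s) reg with
  | [::] => from_empty reg
  | x :: s' => copair (gmap_id reg) (copies_fold s')
  end.

Lemma copies_exists (s : seq X) (x : X) (g : reg) : x \in s ->
  exists2 w, copies_fold s w = g & copies_map s w = gset_act X x g.
Proof.
elim: s => //= y s IH; rewrite inE => /predU1P[->|/IH[w wg wx]].
  by exists (inl g).
by exists (inr w).
Qed.

Lemma copies_orbit (s : seq X) w :
  exists2 x, x \in s & copies_map s w = gset_act X x (copies_fold s w).
Proof.
elim: s w => [[]|y s IH [g|w]] /=; first by exists y; rewrite ?inE ?eqxx.
by have [x xs ->] := IH w; exists x; rewrite ?inE ?xs ?orbT.
Qed.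

Lemma copies_inj (s : seq X) w w' : uniq s ->
  copies_fold s w = copies_fold s w' -> copies_map s w = copies_map s w' -> w = w'.
Proof.
elim: s w w' => [[]//|y s IH [g|w] [g'|w']] //= /andP[ys us].
- by move=> ->.
- move=> ->; have [x xs ->] := copies_orbit w' => /act_inj yx.
  by rewrite yx xs in ys.
- move=> <-; have [x xs ->] := copies_orbit w => /act_inj yx.
  by rewrite -yx xs in ys.
- by move=> ef em; rewrite (IH _ _ us ef em).
Qed.

Lemma tr_copies s b :
  tr k (copies_fold s) (res k (copies_map s) b) = \sum_(x <- s) ev b x.
Proof.
elim: s => [|x s IH]; first by rewrite tr_from_empty big_nil.
rewrite big_cons tr_sum -IH tr_id //; congr (_ + _).
  by apply/esym/res_comp.
rewrite -(@res_comp _ k _ _ _ _ _ (copies_map s)) //.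
exact: tr_ext.
Qed.

Lemma nm_copies s b :
  nm k (copies_fold s) (res k (copies_map s) b) = \prod_(x <- s) ev b x.
Proof.
elim: s => [|x s IH]; first by rewrite nm_from_empty big_nil.
rewrite big_cons nm_sum -IH nm_id //; congr (_ * _).
  by apply/esym/res_comp.
rewrite -(@res_comp _ k _ _ _ _ _ (copies_map s)) //.
exact: nm_ext.
Qed.
End Copies.

(** A pair (g, x) with u x = y g lies in the copy of x g^-1, a point of the
    fibre over y. *)
Lemma copies_pullback (X Y : gset gT) (u : gmap X Y) (y : Y) :
  let s := enum [pred x | u x == y] in
  is_pullback (copies_fold s) (copies_map s) (orb y) u.
Proof.
move=> s; split=> [w | g x /= yg].
  have [x] := copies_orbit w; rewrite mem_enum inE => /eqP ux ->.
  by rewrite gmap_equiv ux.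
have xs : gset_act X x (g : gT)^-1%g \in s.
  by rewrite mem_enum inE gmap_equiv -yg actK.
have [w wg wx] := copies_exists g xs; rewrite actKV in wx.
exists w; split=> // w' [w'g w'x].
by apply: (copies_inj (enum_uniq _)); rewrite ?wg ?wx.
Qed.

(** Base change along the orbit map of y. *)
Lemma ev_tr (X Y : gset gT) (u : gmap X Y) b y :
  ev (tr k u b) y = \sum_(x | u x == y) ev b x.
Proof.
by rewrite /ev (res_tr (copies_pullback u y)) tr_copies big_enum.
Qed.

Lemma ev_nm (X Y : gset gT) (u : gmap X Y) b y :
  ev (nm k u b) y = \prod_(x | u x == y) ev b x.
Proof.
by rewrite /ev (res_nm (copies_pullback u y)) nm_copies big_enum.
Qed.
End Evaluation.

(** * Tambara functors of functions *)

Section FunctionTambara.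
Variables (gT : finGroupType) (R : comPzRingType).

Definition fres (X Y : gset gT) (u : gmap X Y) (f : {ffun Y -> R}) : {ffun X -> R} :=
  [ffun x => f (u x)].
Definition ftr (X Y : gset gT) (u : gmap X Y) (f : {ffun X -> R}) : {ffun Y -> R} :=
  [ffun y => \sum_(x | u x == y) f x].
Definition fnm (X Y : gset gT) (u : gmap X Y) (f : {ffun X -> R}) : {ffun Y -> R} :=
  [ffun y => \prod_(x | u x == y) f x].

Lemma fres_comp (X Y Z : gset gT) (v : gmap Y Z) (u : gmap X Y) (w : gmap X Z) :
  w =1 v \o u -> forall f, fres w f = fres u (fres v f).
Proof. by move=> wE f; apply/ffunP=> x; rewrite !ffunE wE. Qed.

Lemma ftr_comp (X Y Z : gset gT) (v : gmap Y Z) (u : gmap X Y) (w : gmap X Z) :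
  w =1 v \o u -> forall f, ftr w f = ftr v (ftr u f).
Proof.
move=> wE f; apply/ffunP=> z; rewrite !ffunE.
rewrite (partition_big u (fun y => v y == z)) => [|x]; last by rewrite wE.
apply: eq_bigr => y /eqP vy; rewrite ffunE; apply: eq_bigl => x.
by rewrite wE /=; case: (u x =P y) => [->|_]; rewrite ?vy ?eqxx ?andbF.
Qed.

Lemma fnm_comp (X Y Z : gset gT) (v : gmap Y Z) (u : gmap X Y) (w : gmap X Z) :
  w =1 v \o u -> forall f, fnm w f = fnm v (fnm u f).
Proof.
move=> wE f; apply/ffunP=> z; rewrite !ffunE.
rewrite (partition_big u (fun y => v y == z)) => [|x]; last by rewrite wE.
apply: eq_bigr => y /eqP vy; rewrite ffunE; apply: eq_bigl => x.
by rewrite wE /=; case: (u x =P y) => [->|_]; rewrite ?vy ?eqxx ?andbF.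
Qed.

Lemma fres_id (X : gset gT) (u : gmap X X) : u =1 id -> forall f, fres u f = f.
Proof. by move=> uE f; apply/ffunP=> x; rewrite ffunE uE. Qed.

Lemma ftr_id (X : gset gT) (u : gmap X X) : u =1 id -> forall f, ftr u f = f.
Proof.
by move=> uE f; apply/ffunP=> x; rewrite ffunE (big_pred1 x) // => y; rewrite uE.
Qed.

Lemma fnm_id (X : gset gT) (u : gmap X X) : u =1 id -> forall f, fnm u f = f.
Proof.
by move=> uE f; apply/ffunP=> x; rewrite ffunE (big_pred1 x) // => y; rewrite uE.
Qed.

Section Pullback.
Variables (W X Y Z : gset gT) (u' : gmap W X) (v' : gmap W Y).
Variables (v : gmap X Z) (u : gmap Y Z).
Hypothesis sq : is_pullback u' v' v u.

Lemma pullback_big (S : Type) (idx : S) (op : Monoid.com_law idx) (F : Y -> S) x :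
  \big[op/idx]_(y | u y == v x) F y = \big[op/idx]_(w | u' w == x) F (v' w).
Proof.
case: sq => comm univ; apply: big_fibre_bij => [w /eqP <-|y /eqP /esym xy|].
- by rewrite comm.
- by have [w [[<- <-] _]] := univ _ _ xy; exists w; rewrite ?eqxx.
- move=> w w'; rewrite !unfold_in => /eqP wx /eqP w'x vw.
  have [|w0 [_ uniqw]] := univ x (v' w); first by rewrite -wx comm.
  by rewrite -(uniqw w) // -(uniqw w').
Qed.

Lemma fres_tr f : fres v (ftr u f) = ftr u' (fres v' f).
Proof.
apply/ffunP=> x; rewrite !ffunE pullback_big.
by apply: eq_bigr => w _; rewrite ffunE.
Qed.

Lemma fres_nm f : fres v (fnm u f) = fnm u' (fres v' f).
Proof.
apply/ffunP=> x; rewrite !ffunE pullback_big.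
by apply: eq_bigr => w _; rewrite ffunE.
Qed.
End Pullback.

Section Distributivity.
Variables (A X Y : gset gT) (p : gmap A X) (f : gmap X Y).

(** The fibre over w of the projection from the fibre product of X with the
    exponential set is the fibre of f over the base point of w, and the
    evaluation map reads off the section of w. *)
Lemma exp_eval_big (S : Type) (idx : S) (op : Monoid.com_law idx)
    (w : exp_gset p f) (F : option A -> S) :
  \big[op/idx]_(z | exp_proj p f z == w) F (Some (exp_eval p f z)) =
  \big[op/idx]_(x | f x == (val w).1) F ((val w).2 x).
Proof.
rewrite (@big_fibre_bij _ _ _ X (exp_pb p f) (fun x => f x == (val w).1)
  (fun z => exp_proj p f z == w) (fun z => (val z).1)) /=.
- apply: eq_bigr => z /eqP zw; congr F.
  by have /exp_eval_funP := erefl (exp_eval_fun z); rewrite -zw => ->.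
- by move=> z /eqP <-; apply: (valP z).
- move=> x fx; pose z : exp_pb p f := exist _ (x, w) fx.
  by exists z => //=; rewrite eqxx.
- move=> z z'; rewrite !unfold_in => /eqP zw /eqP zw' /= e.
  by apply: val_inj; move: zw zw' e; case: z z' => -[x v] ? [[x' v'] ?] /= -> -> ->.
Qed.

(** Distributivity of products over sums: expanding a product over the fibre
    f^-1(y) of sums over the fibres of p indexes the terms by the sections of p
    over f^-1(y). *)
Lemma fnm_tr (a : {ffun A -> R}) :
  fnm f (ftr p a) = ftr (exp_base p f) (fnm (exp_proj p f) (fres (exp_eval p f) a)).
Proof.
apply/ffunP=> y; rewrite !ffunE.
(* The summation index is moved from A to option A so that the choice
   functions produced by the expansion, which are None off the fibre of f,
   are literally the sections of the exponential set; F None is arbitrary. *)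
pose F (o : option A) : R := if o is Some b then a b else 1.
pose Q (x : X) (o : option A) : bool := if o is Some b then p b == x else false.
transitivity (\prod_(x | f x == y) \sum_(o | Q x o) F o).
  apply: eq_bigr => x _; rewrite ffunE.
  rewrite (@big_fibre_bij _ _ _ (option A) A (Q x) (fun b => p b == x) Some) //.
  - by case=> // b pb; exists b.
  - by move=> b c _ _ [].
rewrite (big_distr_big_dep None) /=.
pose h (w : exp_gset p f) : {ffun X -> option A} := (val w).2.
rewrite (@big_fibre_bij _ _ _ _ (exp_gset p f) _
  (fun w => (val w).1 == y) h) /=.
- apply: eq_bigr => w /eqP <-; rewrite ffunE -(exp_eval_big _ w F).
  by apply: eq_bigr => z _; rewrite ffunE.
- move=> w /eqP <-; have /forallP ws := valP w; apply/pfamilyP; split=> [|x fx].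
    apply/subsetP=> x; rewrite !unfold_in; apply: contraNT => fx.
    by have := ws x; rewrite /h /=; case: (_ x) => // b /andP[]; rewrite (negPf fx).
  have := ws x; rewrite unfold_in /Q /h /= [f x == _]fx.
  by case: (_ x) => [b /andP[]|].
- move=> s /pfamilyP[/subsetP sf sQ].
  have ws : is_fibre_section p f (y, s).
    apply/forallP=> x /=; have := sf x; have := sQ x; rewrite !unfold_in /=.
    case: (s x) => [b|] /=.
      by move=> H /(_ isT) fx; rewrite fx; apply: H.
    by case: (f x == y) => // /(_ isT).
  by exists (exist _ (y, s) ws) => /=.
- move=> w w'; rewrite !unfold_in => /eqP wy /eqP wy' e.
  apply: val_inj; move: wy wy' e; rewrite /h.
  by case: w w' => -[? s] ? [[? s'] ?] /= -> -> ->.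
Qed.
End Distributivity.
End FunctionTambara.

Section SubFunctionTambara.
Variables (gT : finGroupType) (R : comPzRingType).
Variable P : forall X : gset gT, {pred {ffun X -> R}}.

Hypothesis P_subring : forall X, subring_closed (@P X).
Hypothesis P_res : forall (X Y : gset gT) (u : gmap X Y) f,
  f \in @P Y -> fres u f \in @P X.
Hypothesis P_tr : forall (X Y : gset gT) (u : gmap X Y) f,
  f \in @P X -> ftr u f \in @P Y.
Hypothesis P_nm : forall (X Y : gset gT) (u : gmap X Y) f,
  f \in @P X -> fnm u f \in @P Y.

Section Level.
Variable X : gset gT.

HB.instance Definition _ :=
  GRing.isSubringClosed.Build {ffun X -> R} (@P X) (P_subring X).

Record fsub_type := FSub { fsub_val :> {ffun X -> R}; fsub_valP : fsub_val \in @P X }.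

HB.instance Definition _ := [isSub for fsub_val].
HB.instance Definition _ := [Choice of fsub_type by <:].
HB.instance Definition _ :=
  GRing.SubChoice_isSubPzRing.Build _ _ fsub_type (subringClosedP _).

Fact fsub_mulC : commutative (@GRing.mul fsub_type).
Proof.
by move=> f g; apply: val_inj; apply/ffunP=> x; rewrite !ffunE mulrC.
Qed.

HB.instance Definition _ := GRing.PzRing_hasCommutativeMul.Build fsub_type fsub_mulC.
End Level.

Section Maps.
Variables (X Y : gset gT) (u : gmap X Y).

Definition fsub_res (f : fsub_type Y) : fsub_type X := FSub (P_res u (fsub_valP f)).
Definition fsub_tr (f : fsub_type X) : fsub_type Y := FSub (P_tr u (fsub_valP f)).
Definition fsub_nm (f : fsub_type X) : fsub_type Y := FSub (P_nm u (fsub_valP f)).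

Fact fsub_res_zmod : zmod_morphism fsub_res.
Proof. by move=> f g; apply/val_inj/ffunP=> x; rewrite !ffunE. Qed.

Fact fsub_res_monoid : monoid_morphism fsub_res.
Proof. by split=> [|f g]; apply/val_inj/ffunP=> x; rewrite !ffunE. Qed.

HB.instance Definition _ := GRing.isZmodMorphism.Build _ _ fsub_res fsub_res_zmod.
HB.instance Definition _ := GRing.isMonoidMorphism.Build _ _ fsub_res fsub_res_monoid.

Fact fsub_tr_zmod : zmod_morphism fsub_tr.
Proof.
move=> f g; apply/val_inj/ffunP=> y; rewrite !ffunE -sumrB.
by apply: eq_bigr => x _; rewrite !ffunE.
Qed.

HB.instance Definition _ := GRing.isZmodMorphism.Build _ _ fsub_tr fsub_tr_zmod.

Fact fsub_nm_monoid : monoid_morphism fsub_nm.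
Proof.
split=> [|f g]; apply/val_inj/ffunP=> y; rewrite !ffunE.
  by rewrite big1 // => x _; rewrite ffunE.
by rewrite -big_split; apply: eq_bigr => x _; rewrite !ffunE.
Qed.
End Maps.

Fact fsub_empty (a b : fsub_type gset_empty) : a = b.
Proof. by apply/val_inj/ffunP=> -[]. Qed.

(** Stability under sums over fibres makes the extension by zero of a function
    from a summand available, hence the gluing of two functions. *)
Fact fsub_sum (X Y : gset gT) :
  bijective (fun a : fsub_type (gset_sum X Y) =>
    (fsub_res (gset_inl X Y) a, fsub_res (gset_inr X Y) a)).
Proof.
exists (fun ab => fsub_tr (gset_inl X Y) ab.1 + fsub_tr (gset_inr X Y) ab.2).
  move=> a; apply/val_inj/ffunP=> -[z|z]; rewrite !ffunE.
    rewrite (big_pred1 z) => [|x]; last by [].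
    by rewrite big_pred0 // ffunE addr0.
  rewrite big_pred0 // (big_pred1 z) => [|x]; last by [].
  by rewrite ffunE add0r.
move=> [a b]; congr pair; apply/val_inj/ffunP=> z; rewrite !ffunE.
  by rewrite (big_pred1 z) => [|x]; rewrite ?big_pred0 ?addr0.
by rewrite big_pred0 // (big_pred1 z) => [|x]; rewrite ?add0r.
Qed.

Definition fsub : tambara gT.
Proof.
refine (@Tambara gT fsub_type (fun X Y u => fsub_res u) (fun X Y u => fsub_tr u)
  (fun X Y u => fsub_nm u) fsub_nm_monoid _ _ _ _ _ _ fsub_empty fsub_sum _ _ _).
- by move=> X u uE a; apply/val_inj/fres_id.
- by move=> X u uE a; apply/val_inj/ftr_id.
- by move=> X u uE a; apply/val_inj/fnm_id.
- by move=> X Y Z v u w wE a; apply/val_inj/fres_comp.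
- by move=> X Y Z v u w wE a; apply/val_inj/ftr_comp.
- by move=> X Y Z v u w wE a; apply/val_inj/fnm_comp.
- by move=> W X Y Z u' v' v u sq a; apply/val_inj/fres_tr.
- by move=> W X Y Z u' v' v u sq a; apply/val_inj/fres_nm.
- by move=> A X Y p f a; apply/val_inj/fnm_tr.
Defined.
End SubFunctionTambara.

(** * Monic morphisms are injective *)

Section Morphisms.
Variable gT : finGroupType.

Section KernelPair.
Variables (k l : tambara gT) (phi : tmor k l).

Section Level.
Variable X : gset gT.
Definition kpair_pred : {pred k X * k X} := fun ab => phi X ab.1 == phi X ab.2.

Fact kpair_subring : subring_closed kpair_pred.
Proof.
split=> [|a b|a b]; rewrite !unfold_in /= ?eqxx //.
- by move=> /eqP ea /eqP eb; rewrite !rmorphB ea eb.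
- by move=> /eqP ea /eqP eb; rewrite !rmorphM /= ea eb.
Qed.

HB.instance Definition _ :=
  GRing.isSubringClosed.Build (k X * k X)%type kpair_pred kpair_subring.

Record kpair_type := KPair {
  kpair_val :> k X * k X;
  kpair_valP : kpair_val \in kpair_pred
}.

HB.instance Definition _ := [isSub for kpair_val].
HB.instance Definition _ := [Choice of kpair_type by <:].
HB.instance Definition _ :=
  GRing.SubChoice_isSubPzRing.Build _ _ kpair_type (subringClosedP _).
Fact kpair_mulC : commutative (@GRing.mul kpair_type).
Proof. by move=> f g; apply: val_inj; apply: mulrC. Qed.
HB.instance Definition _ := GRing.PzRing_hasCommutativeMul.Build kpair_type kpair_mulC.

Definition kpair_fst (a : kpair_type) : k X := (val a).1.
Definition kpair_snd (a : kpair_type) : k X := (val a).2.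
Fact kpair_fst_zmod : zmod_morphism kpair_fst. Proof. by []. Qed.
Fact kpair_fst_monoid : monoid_morphism kpair_fst. Proof. by []. Qed.
HB.instance Definition _ := GRing.isZmodMorphism.Build _ _ kpair_fst kpair_fst_zmod.
HB.instance Definition _ := GRing.isMonoidMorphism.Build _ _ kpair_fst kpair_fst_monoid.
Fact kpair_snd_zmod : zmod_morphism kpair_snd. Proof. by []. Qed.
Fact kpair_snd_monoid : monoid_morphism kpair_snd. Proof. by []. Qed.
HB.instance Definition _ := GRing.isZmodMorphism.Build _ _ kpair_snd kpair_snd_zmod.
HB.instance Definition _ := GRing.isMonoidMorphism.Build _ _ kpair_snd kpair_snd_monoid.
Fact kpair_val_inj (a b : kpair_type) :
  kpair_fst a = kpair_fst b -> kpair_snd a = kpair_snd b -> a = b.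
Proof.
case: a b => -[a1 a2] ? [[b1 b2] ?]; rewrite /kpair_fst /kpair_snd /= => e1 e2.
by apply: val_inj; rewrite /= e1 e2.
Qed.
End Level.

Section Maps.
Variables (X Y : gset gT) (u : gmap X Y).

Fact kpair_res_subproof (a : kpair_type Y) :
  (res k u (val a).1, res k u (val a).2) \in @kpair_pred X.
Proof. by rewrite unfold_in /= !tmor_res (eqP (kpair_valP a)). Qed.
Fact kpair_tr_subproof (a : kpair_type X) :
  (tr k u (val a).1, tr k u (val a).2) \in @kpair_pred Y.
Proof. by rewrite unfold_in /= !tmor_tr (eqP (kpair_valP a)). Qed.
Fact kpair_nm_subproof (a : kpair_type X) :
  (nm k u (val a).1, nm k u (val a).2) \in @kpair_pred Y.
Proof. by rewrite unfold_in /= !tmor_nm (eqP (kpair_valP a)). Qed.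

Definition kpair_res a := KPair (kpair_res_subproof a).
Definition kpair_tr a := KPair (kpair_tr_subproof a).
Definition kpair_nm a := KPair (kpair_nm_subproof a).

Fact kpair_res_zmod : zmod_morphism kpair_res.
Proof. by move=> a b; apply: kpair_val_inj; apply: rmorphB. Qed.
Fact kpair_res_monoid : monoid_morphism kpair_res.
Proof.
split=> [|a b]; apply: kpair_val_inj.
- exact: rmorph1.
- exact: rmorph1.
- exact: rmorphM.
- exact: rmorphM.
Qed.
Fact kpair_tr_zmod : zmod_morphism kpair_tr.
Proof. by move=> a b; apply: kpair_val_inj; apply: raddfB. Qed.
Fact kpair_nm_monoid : monoid_morphism kpair_nm.
Proof.
split=> [|a b]; apply: kpair_val_inj.
- exact: nm1.
- exact: nm1.
- exact: nmM.
- exact: nmM.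
Qed.

HB.instance Definition _ := GRing.isZmodMorphism.Build _ _ kpair_res kpair_res_zmod.
HB.instance Definition _ := GRing.isMonoidMorphism.Build _ _ kpair_res kpair_res_monoid.
HB.instance Definition _ := GRing.isZmodMorphism.Build _ _ kpair_tr kpair_tr_zmod.
End Maps.

Fact kpair_empty (a b : kpair_type gset_empty) : a = b.
Proof. by apply: kpair_val_inj; apply: tval_empty. Qed.

Fact kpair_sum (X Y : gset gT) :
  bijective (fun a : kpair_type (gset_sum X Y) =>
    (kpair_res (gset_inl X Y) a, kpair_res (gset_inr X Y) a)).
Proof.
exists (fun ab => kpair_tr (gset_inl X Y) ab.1 + kpair_tr (gset_inr X Y) ab.2).
  by move=> a; apply: kpair_val_inj; apply: sum_trE.
move=> [a b]; congr pair; apply: kpair_val_inj.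
- exact: res_inlDtr.
- exact: res_inlDtr.
- exact: res_inrDtr.
- exact: res_inrDtr.
Qed.

Definition kpair : tambara gT.
Proof.
refine (@Tambara gT kpair_type (fun X Y u => kpair_res u) (fun X Y u => kpair_tr u)
  (fun X Y u => kpair_nm u) kpair_nm_monoid _ _ _ _ _ _ kpair_empty kpair_sum _ _ _).
- by move=> X u uE a; apply: kpair_val_inj; apply: res_id.
- by move=> X u uE a; apply: kpair_val_inj; apply: tr_id.
- by move=> X u uE a; apply: kpair_val_inj; apply: nm_id.
- by move=> X Y Z v u w wE a; apply: kpair_val_inj; apply: res_comp.
- by move=> X Y Z v u w wE a; apply: kpair_val_inj; apply: tr_comp.
- by move=> X Y Z v u w wE a; apply: kpair_val_inj; apply: nm_comp.
- by move=> W X Y Z u' v' v u sq a; apply: kpair_val_inj; apply: res_tr.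
- by move=> W X Y Z u' v' v u sq a; apply: kpair_val_inj; apply: res_nm.
- by move=> A X Y p f a; apply: kpair_val_inj; apply: nm_tr.
Defined.

Definition kpair_fst_mor : tmor kpair k :=
  @TMor gT kpair k (fun X => @kpair_fst X) (fun _ _ _ _ => erefl)
    (fun _ _ _ _ => erefl) (fun _ _ _ _ => erefl).
Definition kpair_snd_mor : tmor kpair k :=
  @TMor gT kpair k (fun X => @kpair_snd X) (fun _ _ _ _ => erefl)
    (fun _ _ _ _ => erefl) (fun _ _ _ _ => erefl).

(** Two elements with the same image form an element of the kernel pair, on
    which the two projections agree. *)
Lemma monic_inj : tambara_monic phi -> forall X, injective (phi X).
Proof.
move=> mono X a b ab.
have abP : (a, b) \in @kpair_pred X by apply/eqP.
apply: (mono _ kpair_fst_mor kpair_snd_mor _ X (KPair abP)) => Y c.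
exact/eqP/(kpair_valP c).
Qed.
End KernelPair.
End Morphisms.

(** * Isomorphisms and nonzero Tambara functors *)

Section Morphisms.
Variable gT : finGroupType.

Fact tmor_comp_res (k l m : tambara gT) (psi : tmor l m) (phi : tmor k l)
    (X Y : gset gT) (u : gmap X Y) a :
  psi X (phi X (res k u a)) = res m u (psi Y (phi Y a)).
Proof. by rewrite !tmor_res. Qed.
Fact tmor_comp_tr (k l m : tambara gT) (psi : tmor l m) (phi : tmor k l)
    (X Y : gset gT) (u : gmap X Y) a :
  psi Y (phi Y (tr k u a)) = tr m u (psi X (phi X a)).
Proof. by rewrite !tmor_tr. Qed.
Fact tmor_comp_nm (k l m : tambara gT) (psi : tmor l m) (phi : tmor k l)
    (X Y : gset gT) (u : gmap X Y) a :
  psi Y (phi Y (nm k u a)) = nm m u (psi X (phi X a)).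
Proof. by rewrite !tmor_nm. Qed.

Definition tmor_comp (k l m : tambara gT) (psi : tmor l m) (phi : tmor k l) :
  tmor k m :=
  @TMor gT k m (fun X => psi X \o phi X) (@tmor_comp_res _ _ _ psi phi)
    (@tmor_comp_tr _ _ _ psi phi) (@tmor_comp_nm _ _ _ psi phi).

Lemma tmor_bij_iso (k l : tambara gT) (phi : tmor k l) :
  (forall X, injective (phi X)) -> (forall X b, exists a, phi X a = b) ->
  tambara_iso k l.
Proof.
move=> inj surj.
pose inv X b := sval (cid (surj X b)).
have invK X : cancel (inv X) (phi X) by move=> b; apply: (svalP (cid (surj X b))).
have zm X : zmod_morphism (inv X).
  by move=> a b; apply: inj; rewrite rmorphB !invK.
have mm X : monoid_morphism (inv X).
  by split=> [|a b]; apply: inj; rewrite ?rmorph1 ?rmorphM /= !invK.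
pose invm X : {rmorphism l X -> k X} :=
  HB.pack (inv X) (GRing.isZmodMorphism.Build _ _ (inv X) (zm X))
    (GRing.isMonoidMorphism.Build _ _ (inv X) (mm X)).
have ires (X Y : gset gT) (u : gmap X Y) a : invm X (res l u a) = res k u (invm Y a).
  by apply: inj; rewrite tmor_res /= !invK.
have itr (X Y : gset gT) (u : gmap X Y) a : invm Y (tr l u a) = tr k u (invm X a).
  by apply: inj; rewrite tmor_tr /= !invK.
have inm (X Y : gset gT) (u : gmap X Y) a : invm Y (nm l u a) = nm k u (invm X a).
  by apply: inj; rewrite tmor_nm /= !invK.
exists phi, (TMor ires itr inm) => X; split; last exact: invK.
by move=> a; apply: inj; rewrite /= invK.
Qed.

Lemma inj_monic (k l : tambara gT) (phi : tmor k l) :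
  (forall X, injective (phi X)) -> tambara_monic phi.
Proof. by move=> inj j alpha beta e X a; apply/inj/e. Qed.

Definition gset_pt_act (x : unit) (g : gT) : unit := x.
Definition gset_pt : gset gT :=
  @GSet gT unit (@TotalAction gT unit gset_pt_act (fun _ => erefl)
                  (fun _ _ _ => erefl)).
Definition to_pt (X : gset gT) : gmap X gset_pt :=
  @GMap gT X gset_pt (fun _ => tt) (fun _ _ => erefl).

Lemma no_point_zero (k : tambara gT) (E : gset gT) :
  (E -> False) -> forall a : k E, a = 0.
Proof.
move=> noE a.
have zE x g : False_rect void (noE (gset_act E x g))
    = gset_act gset_empty (False_rect void (noE x)) g by case: (noE x).
pose z := @GMap gT E gset_empty (fun x => False_rect void (noE x)) zE.
rewrite -[a](@res_id _ k _ (gmap_id E)) //.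
rewrite (@res_comp _ k _ _ _ (from_empty E) z) => [|x]; last by case: (noE x).
by rewrite (tval_empty (res k _ a) 0) rmorph0.
Qed.

(** The norm of 0 along G -> pt is a transfer from the set of sections of the
    empty set over G, of which there is none, so it is 0; but the norm of 1
    is 1.  Hence 1 = 0 at the bottom forces 1 = 0 in k(pt). *)
Lemma nonzero_bottom (k : tambara gT) :
  tambara_nonzero k -> 1 <> 0 :> k (gset_reg gT).
Proof.
case=> X nz e; apply: nz.
pose p := from_empty (gset_reg gT); pose f := to_pt (gset_reg gT).
have noexp (w : exp_gset p f) : False.
  have /forallP/(_ 1%g) := valP w.
  by case: (_ 1%g) => [[]|] /=; case: (val w).1.
have nm0 : nm k f 0 = 0.
  by rewrite -(raddf0 (tr k p)) nm_tr (no_point_zero noexp (nm k _ _)) raddf0.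
have pt0 : 1 = 0 :> k gset_pt by rewrite -(nm1 k f) e nm0.
by rewrite -(rmorph1 (res k (to_pt X))) pt0 rmorph0.
Qed.

Lemma nonzero_pt (k : tambara gT) : tambara_nonzero k -> 1 <> 0 :> k gset_pt.
Proof.
by case=> X nz e; apply: nz; rewrite -(rmorph1 (res k (to_pt X))) e rmorph0.
Qed.
End Morphisms.

(** * Functoriality of coinduction *)

Section Coind.
Variables (gT : finGroupType) (H : {group gT}) (l m : tambara (subg_of H)).
Variable phi : tmor l m.

Definition coind_mor : tmor (coind l) (coind m) :=
  @TMor gT (coind l) (coind m) (fun X => phi (res_gset H X))
    (fun X Y u => tmor_res phi (res_gmap H u))
    (fun X Y u => tmor_tr phi (res_gmap H u))
    (fun X Y u => tmor_nm phi (res_gmap H u)).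

Lemma coind_nonzero : tambara_nonzero m -> tambara_nonzero (coind m).
Proof.
move=> /nonzero_pt nz; exists (gset_pt gT) => /= e; apply: nz.
pose u : gmap (gset_pt (subg_of H)) (res_gset H (gset_pt gT)) :=
  @GMap _ (gset_pt (subg_of H)) (res_gset H (gset_pt gT)) id (fun _ _ => erefl).
by rewrite -(rmorph1 (res m u)) e rmorph0.
Qed.
End Coind.

(** * Induced sets *)

Section Induction.
Variables (gT : finGroupType) (H : {group gT}).
Local Notation hT := (subg_of H).
Local Open Scope group_scope.

(** The canonical representatives of the right cosets of H; each g is uniquely
    h t with h = [hpart g] in H and t = [trep g] a representative. *)
Definition transv_pred (t : gT) := repr (H :* t) == t.
Definition transv : finType := {t : gT | transv_pred t}.

Fact transv_subproof g : transv_pred (repr (H :* g)).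
Proof. by rewrite /transv_pred rcoset_repr. Qed.

Definition trep (g : gT) : transv := exist _ (repr (H :* g)) (transv_subproof g).
Definition hpart (g : gT) : hT := subg H (g * (repr (H :* g))^-1).

Lemma hpartE g : sgval (hpart g) = g * (repr (H :* g))^-1.
Proof.
by rewrite /hpart subgK // -mem_rcoset rcoset_sym mem_repr_rcoset.
Qed.

Lemma rcoset_subg (h : hT) g : H :* (sgval h * g) = H :* g.
Proof. by rewrite rcosetM (rcoset_id (subgP h)). Qed.

Lemma trepMl (h : hT) g : trep (sgval h * g) = trep g.
Proof. by apply: val_inj; rewrite /= rcoset_subg. Qed.

Lemma hpartMl (h : hT) g : hpart (sgval h * g) = h * hpart g.
Proof.
by apply: val_inj; rewrite /= !hpartE rcoset_subg mulgA.
Qed.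

Lemma hpart_trep g : g = sgval (hpart g) * val (trep g).
Proof. by rewrite hpartE /= mulgKV. Qed.

Lemma trepK (t : transv) : trep (val t) = t.
Proof. by apply: val_inj => /=; apply/eqP/(valP t). Qed.

Lemma hpart_transv (t : transv) : hpart (val t) = 1.
Proof. by apply: val_inj; rewrite /= hpartE (eqP (valP t)) mulgV. Qed.

Lemma trep_mem (t : transv) : (val t \in H) = (t == trep 1).
Proof.
apply/idP/eqP => [tH|->].
  by have := trepMl (subg H (val t)) 1; rewrite mulg1 (subgK _ tH) trepK.
by rewrite /= rcoset1 (repr_group H) group1.
Qed.
Lemma repr_rcoset1 : repr (H :* 1) = 1.
Proof. by rewrite rcoset1 (repr_group H). Qed.

Lemma hpart_subg (h : hT) : hpart (sgval h) = h.
Proof.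
rewrite -[sgval h]mulg1 hpartMl; apply: val_inj.
by rewrite /= hpartE repr_rcoset1 invg1 !mulg1.
Qed.

Lemma trep_subg (h : hT) : trep (sgval h) = trep 1.
Proof. by rewrite -[sgval h]mulg1 trepMl. Qed.

Section IndGset.
Variable Y : gset hT.

(** The class [y, g] in the quotient of Y x G by (y h, g) ~ (y, h g) is stored
    as its unique representative (y, t) with t in the transversal. *)
Definition ind_act (z : Y * transv) (g : gT) : Y * transv :=
  (gset_act Y z.1 (hpart (val z.2 * g)), trep (val z.2 * g)).

Fact ind_act1 : ind_act^~ 1 =1 id.
Proof. by case=> y t; rewrite /ind_act /= mulg1 hpart_transv act1 trepK. Qed.

Fact ind_actM z : act_morph ind_act z.
Proof.
case: z => y t g g'; rewrite /ind_act -actM mulgA; set x := _ * g.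
have -> : x * g' = sgval (hpart x) * (val (trep x) * g').
  by rewrite mulgA -hpart_trep.
by rewrite hpartMl trepMl.
Qed.

Definition ind : gset gT := @GSet gT (Y * transv)%type (TotalAction ind_act1 ind_actM).

Definition ind_unit_fun (y : Y) : ind := (y, trep 1).

Fact ind_unit_equiv y h :
  ind_unit_fun (gset_act Y y h) = gset_act (res_gset H ind) (ind_unit_fun y) h.
Proof.
by rewrite /= /res_gset_act /= /ind_act /= repr_rcoset1 mul1g hpart_subg trep_subg.
Qed.

Definition ind_unit : gmap Y (res_gset H ind) :=
  @GMap hT Y (res_gset H ind) ind_unit_fun ind_unit_equiv.

Lemma ind_unit_inj : injective ind_unit.
Proof. by move=> y y' []. Qed.
End IndGset.

Section IndMap.
Variables (Y Z : gset hT) (u : gmap Y Z).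

Fact ind_map_equiv (z : ind Y) g :
  (u (gset_act (ind Y) z g).1, (gset_act (ind Y) z g).2) =
  gset_act (ind Z) (u z.1, z.2) g.
Proof. by rewrite /= /ind_act /= gmap_equiv. Qed.

Definition ind_map : gmap (ind Y) (ind Z) :=
  @GMap gT (ind Y) (ind Z) (fun z => (u z.1, z.2)) ind_map_equiv.

(** The square of the units of induction at u is cartesian. *)
Lemma ind_fibre_big (S : Type) (idx : S) (op : Monoid.com_law idx) (F : ind Y -> S) z :
  \big[op/idx]_(w | ind_map w == ind_unit Z z) F w =
  \big[op/idx]_(y | u y == z) F (ind_unit Y y).
Proof.
apply: big_fibre_bij => [y /eqP <- //|[y t] /eqP[uy tE]|y y' _ _].
  by exists y; rewrite ?uy ?eqxx // tE.
exact: ind_unit_inj.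
Qed.
End IndMap.

Section IndCounit.
Variable X : gset gT.

Fact ind_counit_equiv (z : ind (res_gset H X)) g :
  gset_act X (gset_act (ind (res_gset H X)) z g).1
    (val (gset_act (ind (res_gset H X)) z g).2) =
  gset_act X (gset_act X z.1 (val z.2)) g.
Proof.
by case: z => x t /=; rewrite /res_gset_act /= -!actM -hpart_trep.
Qed.

Definition ind_counit : gmap (ind (res_gset H X)) X :=
  @GMap gT (ind (res_gset H X)) X (fun z => gset_act X z.1 (val z.2))
    ind_counit_equiv.

Lemma ind_counit_unit x : ind_counit (ind_unit _ x) = x.
Proof. by rewrite /= repr_rcoset1 act1. Qed.
End IndCounit.
End Induction.

(** * Descent along a ring morphism *)

Section Descent.
Variables (gT : finGroupType) (k : tambara gT) (H : {group gT}).
Variables (R : comPzRingType) (q : {rmorphism k (gset_reg gT) -> R}).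
Local Notation hT := (subg_of H).

Definition point_values (X : gset gT) (b : k X) : {ffun X -> R} :=
  [ffun x => q (ev b x)].

Definition unit_values (Y : gset hT) (b : k (ind Y)) : {ffun Y -> R} :=
  [ffun y => q (ev b (ind_unit Y y))].

(** For R = k(G) and H = G this is the image of k in the functions; in
    general it is the image in the R-valued functions of the restriction of k
    to H, which is Y |-> k(G x_H Y). *)
Definition desc_pred (Y : gset hT) : {pred {ffun Y -> R}} :=
  fun f => `[< exists b : k (ind Y), f = unit_values b >].
Arguments desc_pred : clear implicits.

Lemma desc_predP (Y : gset hT) f :
  reflect (exists b : k (ind Y), f = unit_values b) (f \in desc_pred Y).
Proof. exact: asboolP. Qed.

Fact desc_subring (Y : gset hT) : subring_closed (desc_pred Y).
Proof.
split=> [|f g /desc_predP[a ->] /desc_predP[b ->]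
        |f g /desc_predP[a ->] /desc_predP[b ->]]; apply/desc_predP.
- by exists 1; apply/ffunP=> y; rewrite !ffunE /ev !rmorph1.
- by exists (a - b); apply/ffunP=> y; rewrite !ffunE /ev !rmorphB.
- by exists (a * b); apply/ffunP=> y; rewrite !ffunE /ev !rmorphM.
Qed.

Fact desc_res (X Y : gset hT) (u : gmap X Y) f :
  f \in desc_pred Y -> fres u f \in desc_pred X.
Proof.
case/desc_predP=> b ->; apply/desc_predP; exists (res k (ind_map u) b).
by apply/ffunP=> x; rewrite !ffunE ev_res.
Qed.

(** The values at the points of Y of a transfer along G x_H X -> G x_H Y only
    involve points of X, by [ind_fibre_big]; the same holds for norms. *)
Fact desc_tr (X Y : gset hT) (u : gmap X Y) f :
  f \in desc_pred X -> ftr u f \in desc_pred Y.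
Proof.
case/desc_predP=> b ->; apply/desc_predP; exists (tr k (ind_map u) b).
apply/ffunP=> y; rewrite !ffunE ev_tr ind_fibre_big rmorph_sum.
by apply: eq_bigr => x _; rewrite ffunE.
Qed.

Fact desc_nm (X Y : gset hT) (u : gmap X Y) f :
  f \in desc_pred X -> fnm u f \in desc_pred Y.
Proof.
case/desc_predP=> b ->; apply/desc_predP; exists (nm k (ind_map u) b).
apply/ffunP=> y; rewrite !ffunE ev_nm ind_fibre_big rmorph_prod.
by apply: eq_bigr => x _; rewrite ffunE.
Qed.

Definition desc : tambara hT := fsub desc_subring desc_res desc_tr desc_nm.

Section Unit.
Variable X : gset gT.

Fact desc_unit_subproof (b : k X) : point_values b \in desc_pred (res_gset H X).
Proof.
apply/desc_predP; exists (res k (ind_counit H X) b).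
by apply/ffunP=> x; rewrite !ffunE ev_res ind_counit_unit.
Qed.

Definition desc_unit_fun (b : k X) : desc (res_gset H X) :=
  @FSub hT R desc_pred (res_gset H X) (point_values b) (desc_unit_subproof b).

Fact desc_unit_zmod : zmod_morphism desc_unit_fun.
Proof. by move=> a b; apply/val_inj/ffunP=> x; rewrite !ffunE /ev !rmorphB. Qed.
Fact desc_unit_monoid : monoid_morphism desc_unit_fun.
Proof.
by split=> [|a b]; apply/val_inj/ffunP=> x; rewrite !ffunE /ev ?rmorph1 ?rmorphM.
Qed.
HB.instance Definition _ := GRing.isZmodMorphism.Build _ _ desc_unit_fun desc_unit_zmod.
HB.instance Definition _ :=
  GRing.isMonoidMorphism.Build _ _ desc_unit_fun desc_unit_monoid.
End Unit.

Definition desc_unit : tmor k (coind desc).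
Proof.
refine (@TMor gT k (coind desc) (fun X => @desc_unit_fun X) _ _ _).
- by move=> X Y u b; apply/val_inj/ffunP=> x; rewrite !ffunE ev_res.
- move=> X Y u b; apply/val_inj/ffunP=> y; rewrite !ffunE ev_tr rmorph_sum.
  by apply: eq_bigr => x _; rewrite ffunE.
- move=> X Y u b; apply/val_inj/ffunP=> y; rewrite !ffunE ev_nm rmorph_prod.
  by apply: eq_bigr => x _; rewrite ffunE.
Defined.

Lemma desc_nonzero : 1 <> 0 :> R -> tambara_nonzero desc.
Proof.
move=> nz; exists (gset_pt hT) => /(congr1 val)/ffunP/(_ tt).
by rewrite !ffunE.
Qed.

(** When q is evaluation at 1 on a coinduced ring, such an e is the indicator
    function of H. *)
Definition detects (e : k (gset_reg gT)) : Prop :=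
  forall g : gT, q (res k (left_mul g) e) = (g \in H)%:R.

Section Selector.
Variable e : k (gset_reg gT).
Hypothesis qe : detects e.

Fact coset_equiv (x g : gset_reg gT) :
  (tt, trep H (gset_act (gset_reg gT) x g)) =
  gset_act (ind (gset_pt hT)) (tt, trep H x) g.
Proof.
congr pair => /=.
by rewrite {1}(hpart_trep H x) -mulgA trepMl.
Qed.

Definition coset_map : gmap (gset_reg gT) (ind (gset_pt hT)) :=
  @GMap gT (gset_reg gT) (ind (gset_pt hT)) (fun g => (tt, trep H g)) coset_equiv.

(** The norm of e to G/H, pulled back along G x_H X -> G/H. *)
Definition coset_idem (X : gset gT) : k (ind (res_gset H X)) :=
  res k (ind_map (to_pt (res_gset H X))) (nm k coset_map e).

(** At the coset H t the norm is the product of the e.g for g in H t, and q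
    sends each factor to the same 0 or 1. *)
Lemma coset_idemE X z : q (ev (coset_idem X) z) = (z.2 == trep H 1)%:R.
Proof.
case: z => x t; rewrite ev_res ev_nm rmorph_prod /=.
rewrite (eq_bigr (fun _ => (t == trep H 1)%:R)) => [|g /eqP[<-]]; last first.
  rewrite ev_reg qe -trep_mem; congr (nat_of_bool _)%:R.
  by rewrite {1}(hpart_trep H g) groupMl ?subgP.
rewrite (bigD1 (val t)) /=; last by rewrite trepK.
by case: (t == _); rewrite ?mul0r // mul1r big1.
Qed.

(** If f comes from b in k(G x_H X), the transfer to X of b times the norm of
    e is a preimage: of the points of G x_H X over x, only the class of (x, 1)
    lies over the base coset. *)
Lemma desc_unit_surj X (f : desc (res_gset H X)) : exists b : k X, desc_unit X b = f.
Proof.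
have /desc_predP[b fE] := fsub_valP f.
exists (tr k (ind_counit H X) (coset_idem X * b)).
apply/val_inj/(etrans _ (esym fE))/ffunP=> x; rewrite !ffunE ev_tr rmorph_sum.
rewrite (bigD1 (ind_unit _ x)) /=; last by rewrite repr_rcoset1 act1.
rewrite [ev _ _]rmorphM rmorphM coset_idemE eqxx mul1r big1 ?addr0 //.
move=> [x' t] /= /andP[/eqP <-] neq.
rewrite [ev _ _]rmorphM rmorphM coset_idemE /=.
case: eqP => [tE|_]; last by rewrite mul0r.
by case/eqP: neq; rewrite /ind_unit_fun tE /= repr_rcoset1 act1.
Qed.

Hypothesis k_field : field_like k.
Hypothesis R_nonzero : 1 <> 0 :> R.

Lemma desc_unit_inj X : injective (desc_unit X).
Proof.
apply: monic_inj; apply: k_field.2; apply: coind_nonzero.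
exact: desc_nonzero.
Qed.

Lemma desc_iso : tambara_iso k (coind desc).
Proof. exact: tmor_bij_iso desc_unit_inj desc_unit_surj. Qed.

(** A morphism phi from the descended functor to a nonzero one becomes injective
    after coinduction, because k is field-like.  The coinduced functor sees phi
    at the H-set underlying G x_H Y, and the transfer along the injection
    Y -> G x_H Y embeds the level at Y into that one. *)
Lemma desc_field_like : field_like desc.
Proof.
split=> [|m phi mnz]; first exact: desc_nonzero.
apply: inj_monic => Y a b ab.
have inj : injective (tmor_comp (coind_mor phi) desc_unit (ind Y)).
  by apply: monic_inj; apply: k_field.2; apply: coind_nonzero.
rewrite -(res_trK (k := desc) (@ind_unit_inj _ _ Y) a).
rewrite -(res_trK (k := desc) (@ind_unit_inj _ _ Y) b).
congr (res _ _ _).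
have [a' aE] := desc_unit_surj (tr desc (ind_unit Y) a).
have [b' bE] := desc_unit_surj (tr desc (ind_unit Y) b).
rewrite -aE -bE; congr (desc_unit _ _); apply: inj => /=.
by rewrite aE bE !tmor_tr ab.
Qed.
End Selector.
End Descent.

(** * Clarified functors from minimal subgroups *)

Section CoindEval.
Variables (gT : finGroupType) (K : {group gT}) (S : gring (subg_of K)).

Definition coind_eval1 (f : coind_gring S) : S := coind_val f 1%g.
Fact coind_eval1_zmod : zmod_morphism coind_eval1.
Proof. by move=> f g; rewrite /coind_eval1 !ffunE. Qed.
Fact coind_eval1_monoid : monoid_morphism coind_eval1.
Proof. by split=> [|f g]; rewrite /coind_eval1 !ffunE. Qed.
HB.instance Definition _ :=
  GRing.isZmodMorphism.Build _ _ coind_eval1 coind_eval1_zmod.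
HB.instance Definition _ :=
  GRing.isMonoidMorphism.Build _ _ coind_eval1 coind_eval1_monoid.

Fact coind_delta_subproof :
  [ffun x : gT => (x \in K)%:R : S] \in coind_pred (R := S).
Proof. by apply/coind_predP=> x h; rewrite !ffunE rmorph_nat groupMr ?subgP. Qed.
Definition coind_delta : coind_gring S := CoindType coind_delta_subproof.

Lemma coind_deltaE g :
  coind_eval1 (gring_act (coind_gring S) g coind_delta) = (g \in K)%:R.
Proof. by rewrite /coind_eval1 !ffunE mulg1. Qed.

Lemma coind_gring_nonzero : 1 <> 0 :> coind_gring S -> 1 <> 0 :> S.
Proof.
by move=> nz e; apply/nz/val_inj/ffunP=> x; rewrite !ffunE.
Qed.
End CoindEval.

(** The pair is evaluation at 1 and the indicator function of K. *)
Lemma coind_iso_detects (gT : finGroupType) (k : tambara gT) (K : {group gT})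
    (S : gring (subg_of K)) :
    1 <> 0 :> k (gset_reg gT) -> gring_iso (bottom k) (coind_gring S) ->
  1 <> 0 :> S /\
  exists (q : {rmorphism k (gset_reg gT) -> S}) e, detects K q e.
Proof.
move=> nz [phi bij_phi phi_act]; split.
  apply: coind_gring_nonzero => e; apply: nz; apply: (bij_inj bij_phi).
  by rewrite rmorph0 [LHS]rmorph1 e.
have [psi _ psiK] := bij_phi.
exists (@coind_eval1 _ _ S \o phi), (psi (coind_delta S)) => g /=.
by rewrite phi_act psiK coind_deltaE.
Qed.

Section Inclusion.
Variables (gT : finGroupType) (H : {group gT}) (l : tambara (subg_of H)).
Local Notation hT := (subg_of H).

Definition sub_reg : gmap (gset_reg hT) (res_gset H (gset_reg gT)) :=
  @GMap hT (gset_reg hT) (res_gset H (gset_reg gT)) sgval (fun _ _ => erefl).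

Lemma sub_reg_inj : injective sub_reg.
Proof. exact: val_inj. Qed.

(** The transfer along H -> G extends an element of the bottom ring of l by
    zero; translating the extension by g and restricting back to H gives the
    translate of the element if g is in H, and 0 otherwise because g H and H
    are then disjoint ([translate_extension_out]). *)
Lemma translate_extension_in (h : hT) a :
  res l sub_reg (res l (res_gmap H (left_mul (sgval h))) (tr l sub_reg a)) =
  res l (left_mul h) a.
Proof.
rewrite -{2}[a](res_trK sub_reg_inj).
pose v := gmap_comp (res_gmap H (left_mul (sgval h))) sub_reg.
rewrite -(@res_comp _ l _ _ _ _ _ v) //.
exact: res_comp.
Qed.

Lemma translate_extension_out (g : gT) a : g \notin H ->
  res l sub_reg (res l (res_gmap H (left_mul g)) (tr l sub_reg a)) = 0.
Proof.
move=> gH.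
pose v := gmap_comp (res_gmap H (left_mul g)) sub_reg.
rewrite -(@res_comp _ l _ _ _ _ _ v) //.
have sq : is_pullback (from_empty (gset_reg hT)) (from_empty (gset_reg hT))
    v sub_reg.
  split=> [[]|x y /= e]; case/negP: gH.
  by rewrite -(groupMr g (subgP x)) e subgP.
by rewrite (res_tr sq) tr_from_empty.
Qed.
End Inclusion.

(** If the bottom of the descended functor is coinduced from K < H, compose q
    and the evaluation at 1; the new element is a preimage in k(G) of the
    extension by zero to G of the indicator function of K. *)
Lemma detects_smaller (gT : finGroupType) (k : tambara gT) (H : {group gT})
    (R : comPzRingType) (q : {rmorphism k (gset_reg gT) -> R}) e :
    field_like k -> 1 <> 0 :> R -> detects H q e -> separated (desc H q) ->
  exists (K : {group gT}) (S : comPzRingType)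
      (q' : {rmorphism k (gset_reg gT) -> S}) e',
    [/\ (#|K| < #|H|)%N, 1 <> 0 :> S & detects K q' e'].
Proof.
move=> kf Rnz qe [lf [K [S [Kproper iso]]]].
have [Snz [psi [a psia]]] := coind_iso_detects (nonzero_bottom lf.1) iso.
have [e' e'E] := desc_unit_surj qe (tr (desc H q) (sub_reg H) a).
exists (sgval @* K)%G, S,
  (psi \o (res (desc H q) (sub_reg H) \o desc_unit H q (gset_reg gT))), e'.
split=> //.
  have <- : #|[set: subg_of H]| = #|H|.
    by rewrite -(card_injm (injm_sgval H)) ?im_sgval ?subsetT.
  by rewrite card_injm ?injm_sgval ?subsetT ?proper_card.
move=> g; transitivity (psi (res (desc H q) (sub_reg H)
      (res (desc H q) (res_gmap H (left_mul g)) (tr (desc H q) (sub_reg H) a)))).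
  by rewrite -e'E; congr (psi (res _ _ _)); apply: (tmor_res (desc_unit H q)).
have [gH|gH] := boolP (g \in H).
  have [h ->] : exists h : subg_of H, g = sgval h by exists (Subg gH).
  rewrite [X in psi X]translate_extension_in psia; congr (nat_of_bool _)%:R.
  apply/idP/idP=> [hK|/morphimP[h' _ h'K /val_inj->] //].
  by rewrite mem_morphim ?inE.
rewrite [X in psi X]translate_extension_out // rmorph0.
by case: morphimP => // -[h _ _ gE]; rewrite gE subgP in gH.
Qed.

(** Descent to a subgroup of least order admitting a detecting pair; the search
    starts at G with the identity and 1, and each separated descent gives a
    strictly smaller subgroup. *)
Theorem clarified_coinduction (gT : finGroupType) (k : tambara gT) :
  field_like k ->
  exists (H : {group gT}) (l : tambara (subg_of H)),
    clarified l /\ tambara_iso k (coind l).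
Proof.
move=> kf.
suff main m : forall (H : {group gT}) (R : comPzRingType)
    (q : {rmorphism k (gset_reg gT) -> R}) e,
    (#|H| < m)%N -> 1 <> 0 :> R -> detects H q e ->
  exists (H : {group gT}) (l : tambara (subg_of H)),
    clarified l /\ tambara_iso k (coind l).
- apply: (main #|gT|.+1 [set: gT]%G _ (GRing.RMorphism.clone _ _ idfun _) 1).
  + by rewrite ltnS max_card.
  + exact: nonzero_bottom kf.1.
  + by move=> g; rewrite /= rmorph1 inE.
elim: m => // m IH H R q e Hm Rnz qe.
have [sep|nsep] := pselect (separated (desc H q)); last first.
  exists H, (desc H q); split; last exact: (desc_iso qe).
  by split=> //; apply: desc_field_like qe kf Rnz.
have [K [S [q' [e' [KH Snz q'e']]]]] := detects_smaller kf Rnz qe sep.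
exact: IH (leq_trans KH Hm) Snz q'e'.
Qed.

Theorem theorem1p2 (p n : nat) (hp : prime p) (gT : finGroupType)
    (hcyc : cyclic [set: gT]) (hcard : #|[set: gT]| = (p ^ n)%N)
    (k : tambara gT) (hk : field_like k) :
  exists (i : nat) (H : {group gT}) (l : tambara (subg_of H)),
    [/\ (i <= n)%N, #|H| = (p ^ i)%N, clarified l & tambara_iso k (coind l)].
Proof.
have [H [l [lc iso]]] := clarified_coinduction hk.
have : (#|H| %| p ^ n)%N by rewrite -hcard cardSg ?subsetT.
by case/(dvdn_pfactor _ _ hp) => i le_in cardH; exists i, H, l; split.
Qed.
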